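(* Let $\hat\pi=\frac{\mu-r}{\sigma^2}$ and assume $\hat\pi<1$. For $\lambda_{01}>0$ let $\pi^*=\pi^*(\lambda_{01})$ be the optimal liquid-regime stock fraction and $b=b(\lambda_{01})$ the constant in the liquid-regime value function $V^0(x)=\frac1\rho\log x+b$ of the logarithmic investor, as given in the context. Then, for $\lambda_{01}$ small, $$\pi^*=\hat\pi-\lambda_{01}\pi_1+O(\lambda_{01}^2),\qquad\pi_1=\frac1{\sigma^2}\left(\frac{L}{1-\hat\pi L}+\frac{1-L}{(1-\hat\pi L)^2}\cdot\frac{g(\hat\pi)^{\lambda_{10}/\rho}}{1-g(\hat\pi)^{1+\lambda_{10}/\rho}}\right),$$ and $b=\hat h+\lambda_{01}b_1+O(\lambda_{01}^2)$ with $$b_1=\frac1\rho\Bigl[\frac{r/\rho-1+\log\rho+\lambda_{10}\hat h}{\rho+\lambda_{10}}-\hat h+\frac1\rho\log(1-\hat\pi L)+\frac1{\rho+\lambda_{10}}\log\bigl(1-g(\hat\pi)^{1+\lambda_{10}/\rho}\bigr)\Bigr].$$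
   Context: Parameters: $\lambda_{10}>0$, $\rho>0$, $r,\mu\in\mathbb R$, $\sigma>0$, $L\in[0,1)$; $g(\pi)=\frac{\pi(1-L)}{1-\pi L}$. Put $\theta=\frac{\mu-r}\sigma$ and $\hat h=\frac{r/\rho-1+\log\rho}{\rho}+\frac{\theta^2}{2\rho^2}$, so that $\hat V(x)=\frac1\rho\log x+\hat h$ is the value function of the classical infinite-horizon Merton problem of maximizing $\mathbb E\int_0^\infty e^{-\rho t}\log c_t\,dt$, and $\hat\pi$ is its optimal stock fraction. In the market with liquidity shocks (arriving at rate $\lambda_{01}$, ending at rate $\lambda_{10}$, entailing an instantaneous stock drop by the fraction $L$, with no trading and stock growth rate $r$ during shocks, consumption being paid from cash), the log-investor's liquid-regime value function is $V^0(x)=\frac1\rho\log x+b$ with $$b=\frac{r/\rho-1+\log\rho}{\rho}+\zeta(\pi^* )\,\frac{\rho+\lambda_{10}}{\rho(\rho+\lambda_{01}+\lambda_{10})},$$ where $\pi^*$ is the maximizer over $\pi\in[0,1]$ of $$\zeta(\pi)=\frac{(\mu-r)\pi-\pi^2\sigma^2/2}{\rho}+\frac{\lambda_{01}}{\rho+\lambda_{10}}\log\bigl(1-g(\pi)^{1+\lambda_{10}/\rho}\bigr)+\frac{\lambda_{01}}\rho\log(1-\pi L),$$ and $\pi^*$ is the optimal constant fraction of wealth held in stock in the liquid regime.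
   Formalization: The formal theorem also assumes $\hat\pi>0$: for $\hat\pi=0<L$ one has $\pi^*=0$ for all $\lambda_{01}$ although $\pi_1=L/\sigma^2\ne0$, and for $\hat\pi<0$ the powers of $g(\hat\pi)$ are in general undefined and $\pi^*=0$ does not tend to $\hat\pi$. *)

(* Defs.v *)
From HB Require Import structures.
From mathcomp Require Import all_boot all_order all_algebra.
From mathcomp Require Import all_classical all_reals all_analysis.
Set Implicit Arguments.
Unset Strict Implicit.
Unset Printing Implicit Defensive.
Import Order.TTheory GRing.Theory Num.Theory.
Import numFieldNormedType.Exports.
Local Open Scope classical_set_scope.
Local Open Scope ring_scope.

(* The rate l01 at which liquidity shocks arrive is not part of the record: it
   is the variable of the asymptotic expansions and is passed separately. *)
Record market (R : realType) := Market {
  rho : R;   (* discount rate *)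
  r : R;     (* interest rate *)
  mu : R;    (* drift of the stock *)
  sigma : R; (* volatility of the stock *)
  L : R;     (* fraction by which the stock drops when a shock arrives *)
  l10 : R    (* rate at which a shock ends *)
}.

Definition gshock (R : realType) (m : market R) (p : R) : R :=
  p * (1 - L m) / (1 - p * L m).

Definition theta (R : realType) (m : market R) : R := (mu m - r m) / sigma m.

Definition hhat (R : realType) (m : market R) : R :=
  (r m / rho m - 1 + ln (rho m)) / rho m + theta m ^+ 2 / (2 * rho m ^+ 2).

Definition pihat (R : realType) (m : market R) : R :=
  (mu m - r m) / sigma m ^+ 2.

(* The first logarithm has argument 0 at p = 1, where the objective is -oo for
   l01 > 0.  Hence the objective is extended-real valued and uses [lne], as the
   real [ln] takes the value 0 there. *)
Definition zeta (R : realType) (m : market R) (l01 p : R) : \bar R :=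
  ((((mu m - r m) * p - p ^+ 2 * sigma m ^+ 2 / 2) / rho m)%:E
   + (l01 / (rho m + l10 m))%:E
     * lne (1 - gshock m p `^ (1 + l10 m / rho m))%:E
   + (l01 / rho m * ln (1 - p * L m))%:E)%E.

Definition optimal_fraction (R : realType) (m : market R) (l01 p : R) : Prop :=
  0 <= p <= 1 /\
  forall q : R, 0 <= q <= 1 -> (zeta m l01 q <= zeta m l01 p)%E.

(* The constant b of V^0(x) = ln x / rho + b, where p is the optimal liquid
   fraction.  The maximal value of [zeta] is at least its value 0 at 0, so it
   is finite and [fine] loses nothing. *)
Definition bliquid (R : realType) (m : market R) (l01 p : R) : R :=
  (r m / rho m - 1 + ln (rho m)) / rho m
  + fine (zeta m l01 p)
    * ((rho m + l10 m) / (rho m * (rho m + l01 + l10 m))).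

Definition pi1 (R : realType) (m : market R) : R :=
  1 / sigma m ^+ 2 *
  (L m / (1 - pihat m * L m)
   + (1 - L m) / (1 - pihat m * L m) ^+ 2
     * (gshock m (pihat m) `^ (l10 m / rho m)
        / (1 - gshock m (pihat m) `^ (1 + l10 m / rho m)))).

Definition b1 (R : realType) (m : market R) : R :=
  1 / rho m *
  ((r m / rho m - 1 + ln (rho m) + l10 m * hhat m) / (rho m + l10 m)
   - hhat m
   + 1 / rho m * ln (1 - pihat m * L m)
   + 1 / (rho m + l10 m)
     * ln (1 - gshock m (pihat m) `^ (1 + l10 m / rho m))).

(* Main.v *)
Require Import Defs.
From HB Require Import structures.
From mathcomp Require Import all_boot all_order all_algebra.
From mathcomp Require Import all_classical all_reals all_analysis.
From mathcomp Require Import ring lra.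
Set Implicit Arguments.
Unset Strict Implicit.
Unset Printing Implicit Defensive.
Import Order.TTheory GRing.Theory Num.Theory.
Import numFieldNormedType.Exports.
Local Open Scope classical_set_scope.
Local Open Scope ring_scope.

(* On ]0, 1[ the objective is a constant plus l h(p) - c (p - p0)^2, where p0 is
   the Merton fraction and h <= 0 collects the two logarithms.  Comparing the
   maximizer P with p0 gives c (P - p0)^2 <= - l h(p0), so P tends to p0 and is
   interior for small l.  Stationarity, 2c (P - p0) = l h'(P), then gives
   P - p0 = O(l), and because h' is Lipschitz at p0 this improves to
   P = p0 + l h'(p0) / 2c + O(l^2).  Up to the constant, the maximal value is
   l h(p0) + O(l^2), from which the expansion of b follows. *)

(** * Local bounds and their passage to big-O form *)

(** Difference quotients at [x] converge to some [l], so near [x] they are at most [|l| + 1] in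
    absolute value. *)
Lemma derivable_near_lipschitz (R : realType) (f : R -> R) (x : R) :
  derivable f x 1 ->
  exists2 K : R, 0 < K & \forall y \near x, `|f y - f x| <= K * `|y - x|.
Proof.
move=> /cvg_ex[l /= fl].
exists (`|l| + 1); first by rewrite ltr_pwDr.
have := cvgr_norm_le _ fl (`|l| + 1).
rewrite ltrDl ltr01 => /(_ _ isT) H.
have {H} : \forall h \near (0 : R), h != 0 ->
    `|h^-1 *: (f (h *: 1 + x) - f x)| <= `|l| + 1 by exact: H.
move=> /nbhs_ballP[e /= e0 He]; apply/nbhs_ballP; exists e => //= y xye.
have [->|yx] := eqVneq y x; first by rewrite !subrr normr0 mulr0.
have yx0 : y - x != 0 by rewrite subr_eq0.
have yxe : `|y - x| < e by rewrite distrC.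
have := He (y - x); rewrite /ball/= sub0r normrN => /(_ yxe yx0).
rewrite [_ *: 1]mulr1 subrK normrZ normfV mulrC ler_pdivrMr//.
by rewrite normr_gt0.
Qed.

Lemma eqaddO_sqr_at_right (R : realType) (f g : R -> R) (K : R) : 0 < K ->
  (\forall l \near 0^'+, `|f l - g l| <= K * l ^+ 2) ->
  forall l : R, f l = g l +O_(l \near (0^'+)) (l ^+ 2).
Proof.
move=> K0 fgK.
have /eqaddOP : \forall k \near +oo, \forall l \near 0^'+,
    `|(f - g) l| <= k * `|l ^+ 2|.
  apply/bigO_exP; exists K => //; near=> l.
  rewrite [`|l ^+ 2|]ger0_norm ?sqr_ge0//.
  by near: l; exact: fgK.
by rewrite funeqE.
Unshelve. all: by end_near. Qed.

(** * Maximizers of a concave quadratic under a small perturbation *)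

Lemma perturbed_argmax_cvg (R : realType) (c M p0 : R) (ps : R -> R) : 0 < c ->
  (forall l, 0 < l -> c * (ps l - p0) ^+ 2 <= l * M) ->
  ps l @[l --> 0^'+] --> p0.
Proof.
move=> c0 coarse; apply/cvgrPdist_lt => e e0.
have M0 : 0 <= M.
  have := coarse 1 ltr01; rewrite mul1r; apply: le_trans.
  by rewrite mulr_ge0 ?sqr_ge0 ?ltW.
near=> l.
have l0 : 0 < l by near: l; exact: nbhs_right_gt.
(* Dividing by [M + 1] covers the case [M = 0]; then [l * M <= l * M + l < c * e ^+ 2]. *)
have lM : l < c * e ^+ 2 / (M + 1).
  near: l; apply: nbhs_right_lt.
  by rewrite divr_gt0 ?mulr_gt0 ?exprn_gt0 ?ltr_wpDl.
rewrite distrC -(ltr_pXn2r (n := 2)) ?nnegrE ?(ltW e0)//.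
rewrite real_normK ?num_real// -(ltr_pM2l c0).
apply: le_lt_trans (coarse _ l0) _.
move: lM; rewrite ltr_pdivlMr ?ltr_wpDl// mulrDr mulr1.
by apply: le_lt_trans; rewrite lerDl ltW.
Unshelve. all: by end_near. Qed.

(** Fermat's rule for the penalized objective at an interior maximizer. *)
Lemma perturbed_argmax_stationary (R : realType) (a b c l p p0 : R)
    (h dh : R -> R) :
  (forall q, q \in `]a, b[ -> is_derive q 1 h (dh q)) ->
  p \in `]a, b[ ->
  (forall q, q \in `]a, b[ ->
    l * h q - c * (q - p0) ^+ 2 <= l * h p - c * (p - p0) ^+ 2) ->
  2 * c * (p - p0) = l * dh p.
Proof.
move=> hD pab pmax.
pose F := fun q : R => l * h q - c * (q - p0) ^+ 2.
have FD q : q \in `]a, b[ -> is_derive q 1 F (l * dh q - 2 * c * (q - p0)).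
  move=> /hD hq.
  have -> : F = l \*: h - c \*: ((id - cst p0) ^+ 2) by [].
  apply: is_derive_eq; rewrite [(id - _) q](_ : _ = q - p0)// subr0 expr1.
  by rewrite /GRing.scale /=; ring.
have ab : a <= b by move: pab; rewrite in_itv => /andP[/lt_trans/[apply]/ltW].
have Fd q qab := @ex_derive _ _ _ _ _ _ _ (FD q qab).
have [_ F0] := derive1_at_max ab Fd pab pmax.
have [_ F1] := FD _ pab.
by apply/esym/eqP; rewrite -subr_eq0 -F1 F0.
Qed.

Lemma perturbed_argmax_expansion (R : realType) (a b c M p0 : R)
    (h dh ps : R -> R) :
  p0 \in `]a, b[ -> 0 < c ->
  (forall q, q \in `]a, b[ -> is_derive q 1 h (dh q)) ->
  derivable dh p0 1 ->
  (forall l, 0 < l -> c * (ps l - p0) ^+ 2 <= l * M) ->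
  (forall l q, 0 < l -> ps l \in `]a, b[ -> q \in `]a, b[ ->
    l * h q - c * (q - p0) ^+ 2 <= l * h (ps l) - c * (ps l - p0) ^+ 2) ->
  exists2 K, 0 < K & \forall l \near 0^'+,
    [/\ ps l \in `]a, b[,
        `|ps l - (p0 + l * (dh p0 / (2 * c)))| <= K * l ^+ 2 &
        `|l * h (ps l) - c * (ps l - p0) ^+ 2 - l * h p0| <= K * l ^+ 2].
Proof.
move=> p0ab c0 hD dhD coarse psmax.
have cvgps := perturbed_argmax_cvg c0 coarse.
have [K1 K10 hK1] := derivable_near_lipschitz dhD.
have hd := @ex_derive _ _ _ _ _ _ _ (hD _ p0ab).
have [K2 K20 hK2] := derivable_near_lipschitz hd.
(* [D] bounds [dh] near [p0] by continuity; through stationarity it bounds the displacement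
   [ps l - p0] linearly in [l]. *)
pose D := `|dh p0| + 1; have D0 : 0 < D by rewrite ltr_pwDr.
have hKD : \forall q \near p0, `|dh q| <= D.
  have dhC : {for p0, continuous dh}.
    by apply: differentiable_continuous; exact/derivable1_diffP.
  by apply: (cvgr_norm_le _ dhC); rewrite ltrDl.
have hab : \forall q \near p0, q \in `]a, b[ by exact: near_in_itvoo.
(* The first summand controls the error in the maximizer, the second the error in the maximal
   value. *)
exists (K1 * D / (2 * c) ^+ 2 + K2 * D / (2 * c)).
  by rewrite addr_gt0// divr_gt0// ?mulr_gt0// exprn_gt0// mulr_gt0.
near=> l.
have l0 : 0 < l by near: l; exact: nbhs_right_gt.
have psab : ps l \in `]a, b[ by near: l; exact: (cvgps _ hab).
have lK1 : `|dh (ps l) - dh p0| <= K1 * `|ps l - p0|.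
  by near: l; exact: (cvgps _ hK1).
have lK2 : `|h (ps l) - h p0| <= K2 * `|ps l - p0|.
  by near: l; exact: (cvgps _ hK2).
have lKD : `|dh (ps l)| <= D by near: l; exact: (cvgps _ hKD).
have st : 2 * c * (ps l - p0) = l * dh (ps l).
  apply: (perturbed_argmax_stationary hD psab) => // q qab.
  exact: psmax.
have cc : 0 < 2 * c by rewrite mulr_gt0.
have xE : ps l - p0 = l * (dh (ps l) / (2 * c)).
  by rewrite mulrA -st mulrC mulKf// gt_eqF.
(* Stationarity improves the rate from the square root of [l], given by [coarse], to order [l]. *)
have x_le : `|ps l - p0| <= l * (D / (2 * c)).
  rewrite xE normrM (gtr0_norm l0) ler_pM2l// normrM normfV (gtr0_norm cc).
  by rewrite ler_pM2r// invr_gt0.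
have l20 : 0 <= l ^+ 2 by exact: sqr_ge0.
have A0 : 0 <= K1 * D / (2 * c) ^+ 2 * l ^+ 2.
  by rewrite mulr_ge0// divr_ge0// ?sqr_ge0// mulr_ge0// ltW.
have B0 : 0 <= K2 * D / (2 * c) * l ^+ 2.
  by rewrite mulr_ge0// divr_ge0// ?(ltW cc)// mulr_ge0// ltW.
split => //.
(* The error is exactly [l * (dh (ps l) - dh p0) / (2 * c)]: one factor [l] is explicit, the other
   comes from [lK1] and [x_le]. *)
- rewrite opprD addrA xE -mulrBr -mulrBl normrM (gtr0_norm l0) normrM normfV.
  rewrite (gtr0_norm cc) [leRHS]mulrDl; apply: ler_wpDr => //.
  have -> : K1 * D / (2 * c) ^+ 2 * l ^+ 2
      = l * (K1 * (l * (D / (2 * c))) / (2 * c)).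
    by field; rewrite gt_eqF.
  rewrite ler_pM2l// ler_pM2r ?invr_gt0//; apply: le_trans lK1 _.
  by rewrite ler_pM2l.
- rewrite [leRHS]mulrDl; apply: ler_wpDl => //.
  (* Competition with [p0] makes the difference nonnegative; the upper bound then drops the
     quadratic penalty. *)
  have := psmax _ _ l0 psab p0ab; rewrite subrr expr0n/= mulr0 subr0 => ge.
  rewrite ger0_norm ?subr_ge0//.
  apply: (@le_trans _ _ (l * `|h (ps l) - h p0|)).
    rewrite addrAC -mulrBr; apply: (@le_trans _ _ (l * (h (ps l) - h p0))).
      by rewrite gerBl mulr_ge0 ?sqr_ge0// ltW.
    by rewrite ler_pM2l// ler_norm.
  have -> : K2 * D / (2 * c) * l ^+ 2 = l * (K2 * (l * (D / (2 * c)))).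
    by field; rewrite gt_eqF.
  by rewrite ler_pM2l// (le_trans lK2)// ler_pM2l.
Unshelve. all: by end_near. Qed.

(** * The shock term of the objective and its derivatives *)

(** The coefficient of [l01] in [zeta], with the real [ln]; it is faithful on []0, 1[], where both
    arguments are positive. *)
Definition shock_term (R : realType) (m : market R) (p : R) : R :=
  1 / (rho m + l10 m) * ln (1 - gshock m p `^ (1 + l10 m / rho m))
  + 1 / rho m * ln (1 - p * L m).

Definition dshock_term (R : realType) (m : market R) (p : R) : R :=
  - (1 / rho m *
     (L m / (1 - p * L m)
      + (1 - L m) / (1 - p * L m) ^+ 2
        * (gshock m p `^ (l10 m / rho m)
           / (1 - gshock m p `^ (1 + l10 m / rho m))))).

Section Market.
Context (R : realType) (m : market R).
Hypotheses (l10_gt0 : 0 < l10 m) (rho_gt0 : 0 < rho m).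
Hypotheses (sigma_gt0 : 0 < sigma m).
Hypotheses (L_ge0 : 0 <= L m) (L_lt1 : L m < 1).
Let k := l10 m / rho m.
Let k_gt0 : 0 < k. Proof. exact: divr_gt0. Qed.

Lemma crash_factor_gt0 (p : R) : 0 <= p <= 1 -> 0 < 1 - p * L m.
Proof.
by move=> /andP[p0 p1]; rewrite subr_gt0 (le_lt_trans _ L_lt1) ?ler_piMl.
Qed.

Lemma gshock_gt0 (p : R) : p \in `]0, 1[ -> 0 < gshock m p.
Proof.
rewrite in_itv /= => /andP[p0 p1].
rewrite /gshock divr_gt0 ?mulr_gt0 ?subr_gt0//.
by rewrite -subr_gt0 crash_factor_gt0// !ltW.
Qed.

Lemma gshock_lt1 (p : R) : p \in `]0, 1[ -> gshock m p < 1.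
Proof.
rewrite in_itv /= => /andP[p0 p1].
rewrite /gshock ltr_pdivrMr ?crash_factor_gt0 ?ltW// mul1r; nra.
Qed.

Lemma survival_gt0 (p : R) : p \in `]0, 1[ -> 0 < 1 - gshock m p `^ (1 + k).
Proof.
move=> p01; rewrite subr_gt0.
have := gt0_ltr_powR (addr_gt0 ltr01 k_gt0) _ _ (gshock_lt1 p01).
by rewrite powR1; apply; rewrite nnegrE// ltW// gshock_gt0.
Qed.

(** Half the curvature of the Merton part of the objective, obtained by completing the square around
    [pihat m]. *)
Let c := sigma m ^+ 2 / (2 * rho m).

Lemma zetaE (l p : R) : p \in `]0, 1[ ->
  zeta m l p =
  (c * pihat m ^+ 2 + (l * shock_term m p - c * (p - pihat m) ^+ 2))%:E.
Proof.
move=> p01; rewrite /zeta lne_EFin ?survival_gt0// -EFinM -!EFinD; congr EFin.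
rewrite /shock_term /c /pihat; field.
by rewrite !gt_eqF// addr_gt0.
Qed.

(** Both logarithmic terms are nonpositive. The closed interval is allowed, so the bound applies to
    a maximizer before it is known to be interior. *)
Lemma zeta_le (l p : R) : 0 < l -> 0 <= p <= 1 ->
  (zeta m l p <= (c * pihat m ^+ 2 - c * (p - pihat m) ^+ 2)%:E)%E.
Proof.
move=> l0 p01.
(* The two zeros are the upper bounds for the two logarithmic terms. *)
have -> : c * pihat m ^+ 2 - c * (p - pihat m) ^+ 2
    = ((mu m - r m) * p - p ^+ 2 * sigma m ^+ 2 / 2) / rho m + 0 + 0.
  by rewrite /c /pihat; field; rewrite !gt_eqF.
rewrite !EFinD; apply: leeD; last first.
  rewrite lee_fin; apply: mulr_ge0_le0; first by rewrite divr_ge0// ltW.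
  by rewrite ln_le0// gerBl mulr_ge0//; case/andP: p01.
apply: leeD => //; apply: mule_ge0_le0.
  by rewrite lee_fin divr_ge0// ltW// addr_gt0.
by rewrite lne_le0 lee_fin gerBl powR_ge0.
Qed.

Lemma is_derive_crash_factor (p : R) :
  is_derive p 1 (fun q : R => 1 - q * L m) (- L m).
Proof.
have -> : (fun q : R => 1 - q * L m) = cst 1 - L m \*: id.
  by apply/funext => q /=; rewrite mulrC.
by apply: is_derive_eq; rewrite /GRing.scale/= mulr1 sub0r.
Qed.

Lemma is_derive_gshock (p : R) : p \in `]0, 1[ ->
  is_derive p 1 (gshock m) ((1 - L m) / (1 - p * L m) ^+ 2).
Proof.
rewrite in_itv /= => /andP[p0 p1].
have d0 : 1 - p * L m != 0 by rewrite gt_eqF// crash_factor_gt0// !ltW.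
have dV := is_deriveV (f := fun q => 1 - q * L m) d0 (is_derive_crash_factor p).
have -> : gshock m = ((1 - L m) \*: id) * (fun q : R => (1 - q * L m)^-1).
  by apply/funext => q; rewrite /gshock [q * _]mulrC.
apply: is_derive_eq (is_deriveM _ dV) _.
by rewrite /GRing.scale/= /GRing.scale/=; field.
Qed.

Lemma is_derive_powR_gshock (s p : R) : p \in `]0, 1[ ->
  is_derive p 1 (fun q => gshock m q `^ s)
    (s * gshock m p `^ (s - 1) * ((1 - L m) / (1 - p * L m) ^+ 2)).
Proof.
move=> p01; have sD := @is_derive1_powR R s _ (gshock_gt0 p01).
exact: (is_derive1_comp (g := gshock m) sD (is_derive_gshock p01)).
Qed.

Lemma is_derive_survival (p : R) : p \in `]0, 1[ ->
  is_derive p 1 (fun q : R => 1 - gshock m q `^ (1 + k))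
   (- ((1 + k) * gshock m p `^ k * ((1 - L m) / (1 - p * L m) ^+ 2))).
Proof.
move=> p01; have gD := is_derive_powR_gshock (1 + k) p01.
have -> : (fun q : R => 1 - gshock m q `^ (1 + k))
  = cst 1 - (fun q => gshock m q `^ (1 + k)) by [].
apply: is_derive_eq.
by rewrite sub0r [1 + k]addrC addrK.
Qed.

Lemma is_derive_shock_term (p : R) : p \in `]0, 1[ ->
  is_derive p 1 (shock_term m) (dshock_term m p).
Proof.
move=> p01.
have d0 : 0 < 1 - p * L m.
  by move: p01; rewrite in_itv => /andP[? ?]; rewrite crash_factor_gt0// !ltW.
have s0 := survival_gt0 p01.
have D1 := is_derive1_comp (g := fun q => 1 - gshock m q `^ (1 + k))
  (is_derive1_ln s0) (is_derive_survival p01).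
have D2 := is_derive1_comp (g := fun q => 1 - q * L m)
  (is_derive1_ln d0) (is_derive_crash_factor p).
have DD := is_deriveD (is_deriveZ (1 / (rho m + l10 m)) D1)
  (is_deriveZ (1 / rho m) D2).
apply: is_derive_eq DD _.
rewrite /dshock_term /GRing.scale /= -/k.
(* With the powers as atoms, the factor from the exponent cancels:
   [(1 + k) / (rho m + l10 m) = 1 / rho m]. *)
move: s0; set G := _ `^ (1 + k); set H := _ `^ k; rewrite /k => s0.
by field; rewrite !gt_eqF// addr_gt0.
Qed.

(** This supplies the Lipschitz bound on [dshock_term] at [pihat m]; writing the function as sums
    and products lets derivability be inferred. *)
Lemma derivable_dshock_term (p : R) : p \in `]0, 1[ ->
  derivable (dshock_term m) p 1.
Proof.
move=> p01.
have d0 : 1 - p * L m != 0.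
  move: p01; rewrite in_itv => /andP[? ?].
  by rewrite gt_eqF// crash_factor_gt0// !ltW.
have s0 : 1 - gshock m p `^ (1 + k) != 0 by rewrite gt_eqF// survival_gt0.
have DV := is_deriveV (f := fun q => 1 - q * L m) d0 (is_derive_crash_factor p).
have SV := is_deriveV (f := fun q => 1 - gshock m q `^ (1 + k)) s0
  (is_derive_survival p01).
have GD := is_derive_powR_gshock k p01.
have -> : dshock_term m = - ((1 / rho m) \*:
   (L m \*: (fun q => (1 - q * L m)^-1) + 
    ((1 - L m) \*: (fun q => (1 - q * L m)^-1) ^+ 2) *
    ((fun q => gshock m q `^ k) * (fun q => (1 - gshock m q `^ (1 + k))^-1)))).
  by apply/funext => q; rewrite /dshock_term -exprVn.
exact: ex_derive.
Qed.

(** * Identification of the first-order coefficients *)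

Lemma bliquid_expansion (K l p : R) : 0 < l -> p \in `]0, 1[ ->
  pihat m \in `]0, 1[ ->
  `|l * shock_term m p - c * (p - pihat m) ^+ 2 - l * shock_term m (pihat m)|
    <= K * l ^+ 2 ->
  `|bliquid m l p - (hhat m + l * b1 m)|
    <= (K / rho m
        + `|c * pihat m ^+ 2 / (rho m + l10 m) - shock_term m (pihat m)|
          / (rho m * (rho m + l10 m))) * l ^+ 2.
Proof.
move=> l0 p01 ph01 HV.
have s0 : 0 < rho m + l10 m by rewrite addr_gt0.
have sl0 : 0 < rho m + l + l10 m by rewrite addr_gt0// addr_gt0.
rewrite /bliquid zetaE//=.
set V := l * shock_term m p - _ in HV *.
set H := shock_term m (pihat m) in HV *.
pose w := (rho m + l10 m) / (rho m * (rho m + l + l10 m)).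
(* Here [w = 1 / rho m - l / (rho m * (rho m + l + l10 m))] and [b1 m = (H - c * pihat m ^+ 2 / (rho
   m + l10 m)) / rho m], so the terms of order 0 and 1 cancel. *)
have -> : (r m / rho m - 1 + ln (rho m)) / rho m + (c * pihat m ^+ 2 + V) * w
    - (hhat m + l * b1 m)
  = w * (V - l * H) + (c * pihat m ^+ 2 / (rho m + l10 m) - H)
      / (rho m * (rho m + l + l10 m)) * l ^+ 2.
  rewrite /w /b1 /hhat /theta /H /shock_term /c /pihat.
  by field; rewrite !gt_eqF.
have l20 : 0 <= l ^+ 2 by exact: sqr_ge0.
apply: le_trans (ler_normD _ _) _; rewrite [leRHS]mulrDl; apply: lerD.
  have w0 : 0 <= w by rewrite divr_ge0 ?mulr_ge0 ?ltW.
  have w1 : w <= (rho m)^-1.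
    rewrite /w invfM mulrCA ger_pMr ?invr_gt0// ler_pdivrMr// mul1r.
    by rewrite lerD2r lerDl ltW.
  rewrite normrM (ger0_norm w0) [leRHS]mulrAC [leRHS]mulrC.
  by rewrite ler_pM.
rewrite normrM (ger0_norm l20) ler_wpM2r// normrM ler_wpM2l//.
rewrite gtr0_norm ?invr_gt0 ?mulr_gt0//.
by rewrite lef_pV2 ?posrE ?mulr_gt0// ler_pM2l// lerD2r lerDl ltW.
Qed.

(** Since [2 * c = sigma m ^+ 2 / rho m], the factor [1 / rho m] of [dshock_term] cancels. *)
Lemma pi1E : pi1 m = - (dshock_term m (pihat m) / (2 * c)).
Proof.
rewrite /pi1 /dshock_term /c; set X := L m / _ + _.
by field; rewrite !gt_eqF.
Qed.

End Market.

Theorem mainTheorem4 (R : realType) (m : market R)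
    (l10_gt0 : 0 < l10 m) (rho_gt0 : 0 < rho m) (sigma_gt0 : 0 < sigma m)
    (L_ge0 : 0 <= L m) (L_lt1 : L m < 1)
    (pihat_gt0 : 0 < pihat m) (pihat_lt1 : pihat m < 1)
    (pistar : R -> R)
    (pistar_opt : forall l01 : R, 0 < l01 ->
       optimal_fraction m l01 (pistar l01)) :
  (forall l01 : R,
     pistar l01 = pihat m - l01 * pi1 m +O_(l01 \near (0^'+)) (l01 ^+ 2)) /\
  (forall l01 : R,
     bliquid m l01 (pistar l01)
       = hhat m + l01 * b1 m +O_(l01 \near (0^'+)) (l01 ^+ 2)).
Proof.
pose c := sigma m ^+ 2 / (2 * rho m).
have c0 : 0 < c by rewrite divr_gt0 ?exprn_gt0 ?mulr_gt0.
have ph01 : pihat m \in `]0, 1[ by rewrite in_itv /= pihat_gt0.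
have itvW (q : R) : q \in `]0, 1[ -> 0 <= q <= 1.
  by rewrite in_itv /= => /andP[? ?]; rewrite !ltW.
(* Optimality against [pihat m], where the penalty vanishes, is combined with the upper bound
   [zeta_le] at [pistar l]. *)
have coarse l : 0 < l ->
    c * (pistar l - pihat m) ^+ 2 <= l * - shock_term m (pihat m).
  move=> l0; have [ps01 psmax] := pistar_opt _ l0.
  have := le_trans (psmax _ (itvW _ ph01))
    (zeta_le l10_gt0 rho_gt0 sigma_gt0 L_ge0 l0 ps01).
  rewrite zetaE// lee_fin subrr expr0n/= mulr0 subr0 -/c lerD2l.
  by rewrite mulrN lerNr.
have psmax l q : 0 < l -> pistar l \in `]0, 1[ -> q \in `]0, 1[ ->
    l * shock_term m q - c * (q - pihat m) ^+ 2
      <= l * shock_term m (pistar l) - c * (pistar l - pihat m) ^+ 2.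
  move=> l0 ps01 q01; have [_ /(_ _ (itvW _ q01))] := pistar_opt _ l0.
  by rewrite !zetaE// lee_fin lerD2l.
have [K K0 hK] := perturbed_argmax_expansion ph01 c0
  (is_derive_shock_term l10_gt0 rho_gt0 L_ge0 L_lt1)
  (derivable_dshock_term l10_gt0 rho_gt0 L_ge0 L_lt1 ph01)
  coarse psmax.
split.
  apply: (eqaddO_sqr_at_right K0).
  apply: filterS hK => l [_ + _].
  by rewrite pi1E// mulrN opprK.
(* The constant of [bliquid_expansion]: the error in the maximal value plus that from the dependence
   of the weight on [l]. *)
pose K' := K / rho m
  + `|c * pihat m ^+ 2 / (rho m + l10 m) - shock_term m (pihat m)|
    / (rho m * (rho m + l10 m)).
have K'0 : 0 < K'.
  rewrite ltr_wpDr// ?divr_gt0// divr_ge0// mulr_ge0// ltW// addr_gt0//.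
apply: (eqaddO_sqr_at_right K'0).
apply: filterS2 hK (nbhs_right_gt 0) => l [ps01 _ hV] l0.
exact: bliquid_expansion.
Qed.
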